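(* Let $(S,U,\mathcal{A},C)$ be a WSP instance in which every constraint in $C$ is a not-equals constraint, an at-most-$r$ constraint or an at-least-$r$ constraint (the value of $r$ may depend on the constraint). Then the instance has a solution (a valid complete plan) if and only if there is an assignment of values in $\{0,1\}$ to the variables - $x_{u,s}$, for each pair $(u,s)\in U\times S$ with $s\in A(u)$, - $z_{u,c}$, for each at-least-$r$ constraint $c\in C$ and each user $u\in U$, - $y_{u,c}$, for each at-most-$r$ constraint $c\in C$ and each user $u\in U$, satisfying all of the following: 1. for each step $s\in S$: $\sum_{u\in A(s)}x_{u,s}=1$; 2. for each not-equals constraint $(s,t,\neq)\in C$ and each user $u\in A(s)\cap A(t)$: $x_{u,s}+x_{u,t}\leqslant 1$; 3. for each at-least-$r$ constraint $c=(r,Q,\geqslant)\in C$ and each user $u\in U$: $z_{u,c}\leqslant\sum_{s\in A(u)\cap Q}x_{u,s}$; 4. for each at-least-$r$ constraint $c=(r,Q,\geqslant)\in C$: $\sum_{u\in U}z_{u,c}\geqslant r$; 5. for each at-most-$r$ constraint $c=(r,Q,\leqslant)\in C$, each $s\in Q$ and each $u\in A(s)$: $x_{u,s}\leqslant y_{u,c}$; 6. for each at-most-$r$ constraint $c=(r,Q,\leqslant)\in C$: $\sum_{u\in U}y_{u,c}\leqslant r$.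
   Context: A WSP (workflow satisfiability problem) instance is a tuple $(S,U,\mathcal{A},C)$, where $S$ is a finite set of steps, $U$ a finite set of users, $\mathcal{A}=\{A(u):u\in U\}$ with $A(u)\subseteq S$ the set of steps that user $u$ is authorized to perform, and $C$ a finite set of constraints. For a step $s\in S$, $A(s)=\{u\in U: s\in A(u)\}$ denotes the set of users authorized for $s$. A valid complete plan (solution) is a function $\pi:S\to U$ such that $s\in A(\pi(s))$ for all $s\in S$ and $\pi$ satisfies every constraint in $C$. Types of constraints: - Not-equals constraint $(s,t,\neq)$, with $s,t\in S$: satisfied by $\pi$ iff $\pi(s)\neq\pi(t)$. - At-most-$r$ constraint $(r,Q,\leqslant)$, with $Q\subseteq S$ and $1\leqslant r\leqslant|Q|$: satisfied by $\pi$ iff $|\pi(Q)|\leqslant r$, i.e. at most $r$ distinct users in total are assigned to the steps in $Q$. - At-least-$r$ constraint $(r,Q,\geqslant)$, with $Q\subseteq S$ and $1\leqslant r\leqslant|Q|$: satisfied by $\pi$ iff $|\pi(Q)|\geqslant r$, i.e. at least $r$ distinct users are assigned to the steps in $Q$. Empty sums are $0$. *)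

(* Defs.v *)
From HB Require Import structures.
From mathcomp Require Import all_boot finmap.
Set Implicit Arguments. Unset Strict Implicit. Unset Printing Implicit Defensive.

Inductive constraint (S : finType) : Type :=
| NotEquals of S & S
| AtMost of nat & {set S}
| AtLeast of nat & {set S}.

Arguments NotEquals {S} s t.
Arguments AtMost {S} r Q.
Arguments AtLeast {S} r Q.

(* Encoding used only to equip [constraint S] with decidable equality and
   choice, so that finite sets [{fset constraint S}] can be formed. *)
Section ConstraintChoice.
Variable S : finType.

Definition constraint_encode (c : constraint S) :
    (S * S) + ((nat * {set S}) + (nat * {set S})) :=
  match c with
  | NotEquals s t => inl (s, t)
  | AtMost r Q => inr (inl (r, Q))
  | AtLeast r Q => inr (inr (r, Q))
  end.

Definition constraint_decode
    (p : (S * S) + ((nat * {set S}) + (nat * {set S}))) : constraint S :=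
  match p with
  | inl (s, t) => NotEquals s t
  | inr (inl (r, Q)) => AtMost r Q
  | inr (inr (r, Q)) => AtLeast r Q
  end.

Lemma constraint_encodeK : cancel constraint_encode constraint_decode.
Proof. by case. Qed.

HB.instance Definition _ :=
  Choice.copy (constraint S) (can_type constraint_encodeK).

End ConstraintChoice.

Definition wf_constraint (S : finType) (c : constraint S) : bool :=
  match c with
  | NotEquals _ _ => true
  | AtMost r Q | AtLeast r Q => 1 <= r <= #|Q|
  end.

Definition satisfies (S U : finType) (pi : S -> U) (c : constraint S) : Prop :=
  match c with
  | NotEquals s t => pi s <> pi t
  | AtMost r Q => #|pi @: Q| <= r
  | AtLeast r Q => r <= #|pi @: Q|
  end.

(* [auth W u] is A(u); the set A(s) of users authorized for a step s is
   [{u | s \in auth W u}]. *)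
Record wsp (S U : finType) : Type := WSP {
  auth : U -> {set S};
  constraints : {fset constraint S};
  constraints_wf : forall c, c \in constraints -> wf_constraint c
}.

Definition valid_plan (S U : finType) (W : wsp S U) (pi : S -> U) : Prop :=
  (forall s, s \in auth W (pi s)) /\
  (forall c, c \in constraints W -> satisfies pi c).

(* Main.v *)
Require Import Defs.
From mathcomp Require Import all_boot finmap.

(** A plan [pi] and the variables [x] encode each other: [x] is the indicator of [pi s = u], and the
    equation for [s] says that exactly one authorized user performs [s]. For a constraint on [Q],
    the reference point is the indicator of the image [pi @: Q], whose sum over the users is its
    cardinality ([sum_mem_card]). It is itself a legal choice of both [z] and [y]. Conversely, any
    feasible [z] lies below it and any feasible [y] above it, so the bounds on their sums pass to
    the image. *)

Lemma sum_mem_card (T : finType) (A : {set T}) : \sum_(u : T) (u \in A) = #|A|.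
Proof. by rewrite -sum1_card [RHS]big_mkcond; apply: eq_bigr => u _; case: ifP. Qed.

Lemma sum_bool_gt0 {I : finType} {P b : pred I} :
  (0 < \sum_(i | P i) b i) -> exists2 i, P i & b i.
Proof.
rewrite lt0n sum_nat_eq0 negb_forall => /existsP[i].
by rewrite negb_imply eqb0 negbK => /andP[Pi bi]; exists i.
Qed.

(** Two distinct true indices would already contribute 2 to the sum. *)
Lemma sum_bool_eq1_inj {I : finType} {b : pred I} {i j : I} :
  \sum_(k : I) b k = 1 -> b i -> b j -> i = j.
Proof.
move=> sum1 bi bj; apply/eqP; apply: contra_eqT sum1 => neq_ij.
by rewrite (bigD1 i) //= (bigD1 j) 1?eq_sym //= bi bj.
Qed.

Theorem theorem2 (S U : finType) (W : wsp S U) :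
  (exists pi : S -> U, valid_plan W pi) <->
  (exists (x : forall (u : U) (s : S), s \in auth W u -> bool)
          (z : forall (u : U) (r : nat) (Q : {set S}),
                 AtLeast r Q \in constraints W -> bool)
          (y : forall (u : U) (r : nat) (Q : {set S}),
                 AtMost r Q \in constraints W -> bool),
    (forall s : S,
       \sum_(u : {u : U | s \in auth W u}) x (val u) s (valP u) = 1) /\
    (forall s t : S, NotEquals s t \in constraints W ->
       forall (u : U) (us : s \in auth W u) (ut : t \in auth W u),
       x u s us + x u t ut <= 1) /\
    (forall (r : nat) (Q : {set S}) (c : AtLeast r Q \in constraints W) (u : U),
       z u r Q c <=
       \sum_(s : {s : S | s \in auth W u} | val s \in Q) x u (val s) (valP s)) /\
    (forall (r : nat) (Q : {set S}) (c : AtLeast r Q \in constraints W),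
       \sum_(u : U) z u r Q c >= r) /\
    (forall (r : nat) (Q : {set S}) (c : AtMost r Q \in constraints W)
            (s : S) (u : U) (us : s \in auth W u),
       s \in Q -> x u s us <= y u r Q c) /\
    (forall (r : nat) (Q : {set S}) (c : AtMost r Q \in constraints W),
       \sum_(u : U) y u r Q c <= r)).
Proof.
split=> [[pi [auth_pi sat_pi]] | [x [z [y]]]].
  exists (fun u s _ => pi s == u), (fun u _ (Q : {set S}) _ => u \in pi @: Q),
    (fun u _ (Q : {set S}) _ => u \in pi @: Q).
  split=> [s|].
    rewrite (bigD1 (exist (fun u => s \in auth W u) (pi s) (auth_pi s))) //=.
    rewrite eqxx big1 // => -[u us]; rewrite -val_eqE /= eq_sym.
    by move/negbTE->.
  split=> [s t /sat_pi /= /eqP neq_st u _ _|].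
    by case: eqP => [<-|_]; rewrite ?leq_b1 // eq_sym (negbTE neq_st).
  split=> [r Q _ u|].
    have [/imsetP[s sQ ->]|//] := boolP (u \in pi @: Q).
    by rewrite (bigD1 (exist (fun s' => s' \in auth W (pi s)) s (auth_pi s))) //= eqxx.
  split=> [r Q c|]; first by rewrite sum_mem_card; apply: sat_pi c.
  split=> [r Q _ s u _ sQ|r Q c]; last by rewrite sum_mem_card; apply: sat_pi c.
  by case: eqP => // <-; rewrite imset_f.
move=> [x1 [x_neq [z_le [z_ge [x_le y_le]]]]].
(* Choosing in the subtype of users authorized for [s] makes the extracted plan respect
   authorization by construction. *)
have /fin_all_exists[f xf] s :
    exists v : {u : U | s \in auth W u}, x (val v) s (valP v).
  have [|v _ xv] := @sum_bool_gt0 {u : U | s \in auth W u} predT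
    (fun v => x (val v) s (valP v)); first by rewrite x1.
  by exists v.
(* Needed only for at-least constraints, where a true [x] must be traced back to the chosen user. *)
have x_uniq u s (us : s \in auth W u) : x u s us -> val (f s) = u.
  move=> xus; pose v := exist (fun u => s \in auth W u) u us.
  suff -> : f s = v by [].
  apply: (@sum_bool_eq1_inj _ (fun v => x (val v) s (valP v)) _ _ (x1 s)) => //.
  by rewrite (bool_irrelevance (valP v) us).
exists (fun s => val (f s)); split=> [s|]; first exact: valP (f s).
case=> [s t|r Q|r Q] c; rewrite /satisfies.
(* The authorization proof is generalized first, since its type mentions the user being rewritten;
   the common user then gives 1 + 1 <= 1. *)
- move=> eq_st; have := xf t; move: (valP (f t)); rewrite -eq_st => ut xt.
  by have := x_neq _ _ c _ (valP (f s)) ut; rewrite xf xt.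
- rewrite -sum_mem_card; apply: leq_trans (y_le r Q c).
  apply: leq_sum => u _; case: imsetP => // -[s sQ ->].
  by have := x_le r Q c s _ (valP (f s)) sQ; rewrite xf.
- rewrite -sum_mem_card; apply: leq_trans (z_ge r Q c) _.
  (* If [z] is 1 at [u], some step of [Q] has its [x] equal to 1 at [u], so [u] lies in the
     image. *)
  apply: leq_sum => u _; case zu: (z u r Q c) => //.
  have := z_le r Q c u; rewrite zu => /sum_bool_gt0[s sQ /x_uniq <-].
  by rewrite lt0b; apply/imsetP; exists (val s).
Qed.
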